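(* Let $p\ge 2$ and let $\Gamma$ be a random matrix having the Haar probability distribution on the group $\mathcal{O}_p$ of $p\times p$ real orthogonal matrices, with the null set where $\Gamma_{11}\in\{-1,1\}$ removed from its sample space. Partition $$\Gamma=\begin{pmatrix}\Gamma_{11}&\Gamma_{12}\\ \Gamma_{21}&\Gamma_{22}\end{pmatrix}$$ with $\Gamma_{11}$ of size $1\times 1$, $\Gamma_{12}$ of size $1\times(p-1)$, $\Gamma_{21}$ of size $(p-1)\times 1$ and $\Gamma_{22}$ of size $(p-1)\times(p-1)$. Let $U_1,U_2$ be independent random vectors, each uniformly distributed on the unit sphere $\mathcal{S}_{p-1}=\{x\in\mathbb{R}^{p-1}: \|x\|=1\}$. Then, for fixed $\Gamma_{11}\in(-1,1)$, $$\mathcal{L}(\Gamma_{21},\Gamma_{12}\mid\Gamma_{11})=\mathcal{L}\left((1-\Gamma_{11}^2)^{1/2}U_1,\ (1-\Gamma_{11}^2)^{1/2}U_2'\right),$$ i.e. the family of joint laws of $\left((1-\gamma^2)^{1/2}U_1,(1-\gamma^2)^{1/2}U_2'\right)$, $\gamma\in(-1,1)$, is a version of the conditional distribution of $(\Gamma_{21},\Gamma_{12})$ given $\Gamma_{11}=\gamma$.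
   Context: $\mathcal{L}(\cdot)$ denotes the distribution (probability law) of a random object and $\mathcal{L}(\cdot\mid * )$ denotes the conditional distribution of ''$\cdot$'' given ''$*$''. A prime denotes transpose; vectors in $\mathbb{R}^{p-1}$ are column vectors. The Haar distribution on $\mathcal{O}_p$ is the unique probability distribution with $\mathcal{L}(\Gamma)=\mathcal{L}(g_1\Gamma)=\mathcal{L}(\Gamma g_2)$ for all $g_1,g_2\in\mathcal{O}_p$. The uniform distribution on $\mathcal{S}_{p-1}$ (the unit sphere of $\mathbb{R}^{p-1}$) is the unique probability distribution on it invariant under $\mathcal{O}_{p-1}$. *)

(* Defs.v *)
From HB Require Import structures.
From mathcomp Require Import all_boot all_order all_algebra.
From mathcomp Require Import all_classical all_reals all_analysis.
From mathcomp Require Import measurable_realfun.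

Set Implicit Arguments.
Unset Strict Implicit.
Unset Printing Implicit Defensive.

Import Order.TTheory GRing.Theory Num.Theory.
Import numFieldNormedType.Exports.

Local Open Scope classical_set_scope.
Local Open Scope ring_scope.

(* Spaces of real matrices carry their Borel sigma-algebra; the topology on
   'M[R]_(m, n) is the entrywise (product) one. *)
Section matrix_borel.
Variables (R : realType) (m n : nat).

Definition mx_borel : set (set 'M[R]_(m, n)) := <<s @open 'M[R]_(m, n) >>.

HB.instance Definition _ :=
  @isMeasurable.Build (sigma_display (@open 'M[R]_(m, n))) 'M[R]_(m, n)
    mx_borel (@sigma_algebra0 _ setT _) (@sigma_algebraC _ _)
    (@sigma_algebra_bigcup _ setT _).

End matrix_borel.

Section matrix_measurable_functions.
Variable R : realType.

Lemma continuous_mxP (T : topologicalType) m n (f : T -> 'M[R]_(m, n)) :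
  (forall i j, continuous (fun x => f x i j)) -> continuous f.
Proof.
move=> cf x A [B nB sBA].
rewrite /nbhs/=; apply: (filterS (P := fun y => forall i j, B i j (f y i j))).
  by move=> y Hy; apply: sBA.
by apply: filter_forall => i; apply: filter_forall => j; apply: cf.
Qed.

Lemma continuous_entry m n i j : continuous (fun M : 'M[R]_(m, n) => M i j).
Proof.
move=> M A nA; exists (fun i' j' => [set x | i' = i -> j' = j -> A x]) => /=.
  move=> i' j'; have [->|ni] := eqVneq i' i; have [->|nj] := eqVneq j' j.
  - by apply: filterS nA => x Ax _ _.
  - by apply: filterE => x _ /eqP; rewrite (negPf nj).
  - by apply: filterE => x /eqP; rewrite (negPf ni).
  - by apply: filterE => x /eqP; rewrite (negPf ni).
by move=> N HN; apply: HN.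
Qed.

Lemma continuous_mx_measurable m n m' n' (f : 'M[R]_(m, n) -> 'M[R]_(m', n')) :
  continuous f -> measurable_fun setT f.
Proof.
move=> /continuousP cf; apply: (measurability (@open 'M[R]_(m', n'))) => //.
by move=> _ [B oB <-]; rewrite setTI; apply: sub_sigma_algebra; exact: cf.
Qed.

Lemma measurable_entry m n i j :
  measurable_fun setT (fun M : 'M[R]_(m, n) => M i j).
Proof.
apply: (measurability _ (RGenOpens.measurableE R)) => //.
move=> _ [_ [a [b ->]] <-]; rewrite setTI; apply: sub_sigma_algebra.
have /continuousP := @continuous_entry m n i j; apply; exact: interval_open.
Qed.

Lemma measurable_dlsubmx m1 m2 n1 n2 :
  measurable_fun setT (@dlsubmx R m1 m2 n1 n2).
Proof.
apply: continuous_mx_measurable; apply: continuous_mxP => i j.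
by under eq_fun do rewrite !mxE; exact: continuous_entry.
Qed.

Lemma measurable_ursubmx m1 m2 n1 n2 :
  measurable_fun setT (@ursubmx R m1 m2 n1 n2).
Proof.
apply: continuous_mx_measurable; apply: continuous_mxP => i j.
by under eq_fun do rewrite !mxE; exact: continuous_entry.
Qed.

Lemma measurable_scalemx m n (c : R) :
  measurable_fun setT (fun M : 'M[R]_(m, n) => c *: M).
Proof.
apply: continuous_mx_measurable; apply: continuous_mxP => i j.
under eq_fun do rewrite !mxE.
move=> M; apply: (@cvgMl_tmp _ _ _ (nbhs_filter M)).
exact: continuous_entry.
Qed.

Lemma measurable_trmx m n : measurable_fun setT (@trmx R m n).
Proof.
apply: continuous_mx_measurable; apply: continuous_mxP => i j.
by under eq_fun do rewrite !mxE; exact: continuous_entry.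
Qed.

End matrix_measurable_functions.

Section blocks.
Context d (T : measurableType d) (R : realType) (n : nat).
Variable G : {mfun T >-> 'M[R]_(1 + n)}.

Definition block11 (w : T) : R := ulsubmx (G w) ord0 ord0.

Definition block21_12 (w : T) : 'cV[R]_n * 'rV[R]_n :=
  (dlsubmx (G w), ursubmx (G w)).

Let measurable_block11 : measurable_fun setT block11.
Proof.
rewrite /block11; under eq_fun do rewrite !mxE.
exact: (measurableT_comp (measurable_entry _ _) (measurable_funPT G)).
Qed.

HB.instance Definition _ :=
  isMeasurableFun.Build _ _ _ _ block11 measurable_block11.

Let measurable_block21_12 : measurable_fun setT block21_12.
Proof.
apply: measurable_fun_pair.
- exact: (measurableT_comp (@measurable_dlsubmx _ _ _ _ _) (measurable_funPT G)).
- exact: (measurableT_comp (@measurable_ursubmx _ _ _ _ _) (measurable_funPT G)).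
Qed.

HB.instance Definition _ :=
  isMeasurableFun.Build _ _ _ _ block21_12 measurable_block21_12.

End blocks.

Section scaled_pair.
Context d (T : measurableType d) (R : realType) (n : nat).
Variables (c : R) (U1 U2 : {mfun T >-> 'cV[R]_n}).

Definition scaled_pair (w : T) : 'cV[R]_n * 'rV[R]_n :=
  (c *: U1 w, c *: (U2 w)^T).

Let measurable_scaled_pair : measurable_fun setT scaled_pair.
Proof.
apply: measurable_fun_pair.
- exact: (measurableT_comp (measurable_scalemx c) (measurable_funPT U1)).
- apply: (measurableT_comp (measurable_scalemx c)).
  exact: (measurableT_comp (@measurable_trmx _ _ _) (measurable_funPT U2)).
Qed.

HB.instance Definition _ :=
  isMeasurableFun.Build _ _ _ _ scaled_pair measurable_scaled_pair.

End scaled_pair.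

Definition orthogonal_group (R : realType) n : set 'M[R]_n :=
  [set g | g^T *m g = 1%:M].

(* The library norm on matrices is the sup norm, hence this definition. *)
Definition euclidean_norm (R : realType) n (x : 'cV[R]_n) : R :=
  Num.sqrt (\sum_(i < n) x i ord0 ^+ 2).

Definition unit_sphere (R : realType) n : set 'cV[R]_n :=
  [set x | euclidean_norm x = 1].

Definition is_haar (R : realType) n (mu : probability 'M[R]_n R) : Prop :=
  mu (@orthogonal_group R n) = 1%E /\
  forall g, orthogonal_group g -> forall A : set 'M[R]_n, measurable A ->
    pushforward mu (fun x => g *m x) A = mu A /\
    pushforward mu (fun x => x *m g) A = mu A.

Definition is_uniform_sphere (R : realType) n (mu : probability 'cV[R]_n R) :
    Prop :=
  mu (@unit_sphere R n) = 1%E /\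
  forall g : 'M[R]_n, orthogonal_group g ->
  forall A : set 'cV[R]_n, measurable A ->
    pushforward mu (fun x => g *m x) A = mu A.

Definition independent_RV d d1 d2 (T : measurableType d)
    (S1 : measurableType d1) (S2 : measurableType d2) (R : realType)
    (P : probability T R) (X : {RV P >-> S1}) (Y : {RV P >-> S2}) : Prop :=
  forall A B, measurable A -> measurable B ->
    P (X @^-1` A `&` Y @^-1` B) = (P (X @^-1` A) * P (Y @^-1` B))%E.

(* The family (K x), for x in D, is a version of the conditional distribution
   of Y given X = x (a regular conditional distribution), where X takes its
   values in D almost surely; the values of K outside D are irrelevant. *)
Definition is_conditional_distribution d d1 d2 (T : measurableType d)
    (S1 : measurableType d1) (S2 : measurableType d2) (R : realType)
    (P : probability T R) (Y : {RV P >-> S2}) (X : {RV P >-> S1})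
    (D : set S1) (K : S1 -> probability S2 R) : Prop :=
  [/\ measurable D, P (X @^-1` D) = 1%E,
      forall B, measurable B -> measurable_fun D (fun x => K x B) &
      forall A B, measurable A -> A `<=` D -> measurable B ->
        P (X @^-1` A `&` Y @^-1` B) =
        (\int[distribution P X]_(x in A) K x B)%E].

(* Main.v *)
Require Import Defs.
From HB Require Import structures.
From mathcomp Require Import all_boot all_order all_algebra.
From mathcomp Require Import all_classical all_reals all_analysis.
From mathcomp Require Import measurable_realfun ring.

Set Implicit Arguments.
Unset Strict Implicit.
Unset Printing Implicit Defensive.

Import Order.TTheory GRing.Theory Num.Theory.
Import numFieldNormedType.Exports.

Local Open Scope classical_set_scope.
Local Open Scope ring_scope.

(** Write a matrix [G] as its corner [G11], the rest of its first column and
    the rest of its first row. If [G] is orthogonal, these two remainders both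
    have squared length [1 - G11 ^ 2], so away from [G11 = 1, -1] they are
    [radius G11] times two points of the unit sphere, the column direction and
    the row direction of [G]. The theorem amounts to saying that under the Haar
    law the corner and the two directions are independent and that the
    directions are uniform (haar_directions): the conditional law is then a
    section of a product measure, scaled back by the radius.

    Multiplying on the left by diag(1, g), with [g] orthogonal, rotates the
    column direction by [g] and changes neither the corner nor the row
    direction. So the law of the column direction, restricted to any event
    about the other two, is a rotation invariant finite measure on the sphere,
    hence a multiple of the uniform law (uniform_on_event).
    Multiplication on the right does the same for the row direction.

    The uniqueness of invariant measures on the sphere
    (invariant_measure_unique) is obtained without integrating over the
    rotation group. By transitivity, an invariant measure [mu] gives the same
    mass to all balls of a given radius centred on the sphere [S]. If the balls
    centred in [H] stay inside [G], integrating the [mu \x nu]-mass of pairs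
    of close points in two orders gives (packing)
      nu(ball) * mu(H) <= mu(ball) * nu(G),
    and with [H] and [G] the whole space, equality of nu(ball) * mu(S) and
    mu(ball) * nu(S). Balls have positive mass, so they cancel, leaving
    mu(H) * nu(S) <= mu(S) * nu(G). An open [G] is exhausted by such sets [H]
    as the radius tends to 0, and exchanging [mu] and [nu] turns the inequality
    into an equality on open sets, hence on all Borel sets. *)

(** * Measurability of matrix valued functions *)

Section rational_boxes.
Variables (R : realType) (m n : nat).

Definition ratbox (b : 'M[rat]_(m, n) * nat) : set 'M[R]_(m, n) :=
  [set x | forall i j, `|x i j - ratr (b.1 i j)| < b.2.+1%:R^-1].

Lemma open_ratbox (G : set 'M[R]_(m, n)) x : open G -> G x ->
  exists b, ratbox b x /\ ratbox b `<=` G.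
Proof.
move=> oG Gx.
have /nbhs_ballP[e /= e0 xeG] : nbhs x G by exact: open_nbhs_nbhs.
have e20 : 0 < e / 2 by exact: divr_gt0.
have [k] : exists k, 0 + k.+1%:R^-1 < e / 2 by exact: ltr_add_invr.
rewrite add0r => ke.
have k0 : 0 < k.+1%:R^-1 :> R by rewrite invr_gt0.
have /choice[q qP] (ij : 'I_m * 'I_n) : exists q : rat,
    `|x ij.1 ij.2 - ratr q| < k.+1%:R^-1.
  have [|q] := @rat_in_itvoo R (x ij.1 ij.2 - k.+1%:R^-1)
      (x ij.1 ij.2 + k.+1%:R^-1).
    by rewrite ltrD2l gtrN.
  by rewrite in_itv/= => qx; exists q; rewrite distrC ltr_distl.
exists (\matrix_(i, j) q (i, j), k); split.
  by move=> i j /=; rewrite mxE; exact: (qP (i, j)).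
move=> y yb; apply: xeG; split => // i j.
rewrite /ball/= -[x i j](subrK (ratr (q (i, j)))) -addrA.
apply: (le_lt_trans (ler_normD _ _)); rewrite [e]splitr; apply: ltrD.
  exact: lt_trans (qP (i, j)) ke.
by have := yb i j; rewrite /= mxE distrC => /lt_trans; exact.
Qed.

(** An open set is a union of rational boxes, of which there are countably many,
    so the Borel sigma-algebra of matrices is generated by the entries. This is
    what makes functions of several matrices measurable for the product
    sigma-algebra, where joint continuity alone would not suffice. *)
Lemma measurable_fun_mx d (T : measurableType d) (D : set T)
    (f : T -> 'M[R]_(m, n)) :
  (forall i j, measurable_fun D (fun t => f t i j)) -> measurable_fun D f.
Proof.
move=> mf mD; move: (mD); apply: (measurability (@open 'M[R]_(m, n))) => //.
move=> _ [G oG <-].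
have -> : D `&` f @^-1` G = \bigcup_b
    (if `[< ratbox b `<=` G >] then D `&` f @^-1` ratbox b else set0).
  apply/seteqP; split => [t [Dt Gft]|t [b _]].
    have [b [bt bG]] := open_ratbox oG Gft.
    by exists b => //; case: asboolP.
  by case: asboolP => // bG [Dt bt]; split => //; exact: bG.
apply: countable_bigcupT_measurable => // b.
case: asboolP => // _.
have -> : D `&` f @^-1` ratbox b = \bigcap_(ij in [set: 'I_m * 'I_n])
    (D `&` (fun t => f t ij.1 ij.2) @^-1`
      [set r | `|r - ratr (b.1 ij.1 ij.2)| < b.2.+1%:R^-1]) `&` D.
  apply/seteqP; split => [t [Dt bt]|t [bt Dt]]; split => //.
    by move=> [i j] _; split => //; exact: bt.
  by move=> i j; have [] := bt (i, j) I.
apply: measurableI => //; apply: fin_bigcap_measurable => // -[i j] _.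
apply: mf => //=.
set c := ratr _; set e := _^-1.
have -> : [set r : R | `|r - c| < e] = `]c - e, c + e[%classic.
  by apply/seteqP; split=> r /=; rewrite in_itv/= ltr_distl.
exact: measurable_itv.
Qed.

End rational_boxes.

Lemma measurable_mulmx (R : realType) d (T : measurableType d) (D : set T) m n p
    (f : T -> 'M[R]_(m, n)) (g : T -> 'M[R]_(n, p)) :
  measurable_fun D f -> measurable_fun D g ->
  measurable_fun D (fun t => f t *m g t).
Proof.
move=> mf mg; apply: measurable_fun_mx => i j.
under eq_fun do rewrite mxE.
apply: measurable_sum => k; apply: measurable_funM.
  exact: (measurableT_comp (measurable_entry _ _) mf).
exact: (measurableT_comp (measurable_entry _ _) mg).
Qed.

Lemma measurable_funZmx (R : realType) d (T : measurableType d) (D : set T) m n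
    (c : T -> R) (f : T -> 'M[R]_(m, n)) :
  measurable_fun D c -> measurable_fun D f ->
  measurable_fun D (fun t => c t *: f t).
Proof.
move=> mc mf; apply: measurable_fun_mx => i j.
under eq_fun do rewrite mxE.
apply: measurable_funM => //.
exact: (measurableT_comp (measurable_entry _ _) mf).
Qed.

Lemma measurable_funBmx (R : realType) d (T : measurableType d) (D : set T) m n
    (f g : T -> 'M[R]_(m, n)) :
  measurable_fun D f -> measurable_fun D g ->
  measurable_fun D (fun t => f t - g t).
Proof.
move=> mf mg; apply: measurable_fun_mx => i j.
under eq_fun do rewrite !mxE.
apply: measurable_funB; exact: (measurableT_comp (measurable_entry _ _)).
Qed.

(** * Euclidean geometry of column vectors *)

Section sqnorm.
Variables (R : realType) (n : nat).
Implicit Types x y z : 'cV[R]_n.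

Definition sqnorm x : R := (x^T *m x) 0 0.

Lemma sqnormE x : sqnorm x = \sum_i x i 0 ^+ 2.
Proof. by rewrite /sqnorm mxE; apply: eq_bigr => i _; rewrite mxE. Qed.

Lemma sqnormZ c x : sqnorm (c *: x) = c ^+ 2 * sqnorm x.
Proof.
rewrite /sqnorm -scalemxAr [(c *: x)^T]linearZ/= -scalemxAl scalerA mxE.
by rewrite expr2.
Qed.

Lemma sqnormN x : sqnorm (- x) = sqnorm x.
Proof. by rewrite -scaleN1r sqnormZ sqrrN expr1n mul1r. Qed.

Lemma sqnorm_orthogonal g x : orthogonal_group g ->
  sqnorm (g *m x) = sqnorm x.
Proof.
by move=> og; rewrite /sqnorm trmx_mul mulmxA -(mulmxA x^T) og mulmx1.
Qed.

Lemma unit_sphereE : @unit_sphere R n = [set x | sqnorm x = 1].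
Proof.
apply/seteqP; split => x; rewrite /unit_sphere/= /euclidean_norm sqnormE => x1.
  rewrite -[RHS](expr1n _ 2) -x1 sqr_sqrtr//.
  by apply: sumr_ge0 => i _; exact: sqr_ge0.
by rewrite x1 sqrtr1.
Qed.

Lemma continuous_sqnormB x : continuous (fun y => sqnorm (y - x)).
Proof.
under eq_fun do rewrite sqnormE.
have cf i : continuous (fun y : 'cV[R]_n => (y - x) i 0 ^+ 2).
  move=> y; under eq_fun do rewrite !mxE.
  apply: (@continuous_comp _ _ _ (fun y : 'cV[R]_n => y i 0)
    (fun t => (t + - x i 0) ^+ 2)).
    exact: continuous_entry.
  apply: (@continuous_comp _ _ _ (fun t : R => t + - x i 0)
    (fun t => t ^+ 2)).
    by apply: cvgD; [exact: cvg_id|exact: cvg_cst].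
  exact: exprn_continuous.
apply: (@continuous_big R 'I_n +%R 0 xpredT add_continuous) => i _.
exact: cf.
Qed.

Lemma measurable_sqnorm d (T : measurableType d) (D : set T)
    (f : T -> 'cV[R]_n) :
  measurable_fun D f -> measurable_fun D (fun t => sqnorm (f t)).
Proof.
move=> mf; rewrite /sqnorm.
apply: (measurableT_comp (measurable_entry 0 0)).
apply: measurable_mulmx => //.
exact: (measurableT_comp (@measurable_trmx _ _ _)).
Qed.

Lemma measurable_sphere : measurable (@unit_sphere R n).
Proof.
rewrite unit_sphereE -[X in measurable X]setTI.
have msq := measurable_sqnorm (@measurable_id _ _ setT).
exact: msq measurableT _ (measurable_set1 1).
Qed.

(** The witness is the Householder reflection across the hyperplane orthogonal to
    [w = x - y]; as [x] and [y] have the same length, [w^T x] is half of the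
    squared length of [w], and the reflection takes [x] to [x - w = y]. *)
Lemma sphere_transitive x y : unit_sphere x -> unit_sphere y ->
  exists2 g : 'M[R]_n, orthogonal_group g & g *m x = y.
Proof.
rewrite !unit_sphereE /= => x1 y1.
have [->|xy] := eqVneq x y.
  by exists 1%:M; rewrite /orthogonal_group/= ?trmx1 mul1mx.
pose w := x - y.
have mx11 (a : 'M[R]_1) : a = (a 0 0)%:M by exact: mx11_scalar.
have w0 : sqnorm w != 0.
  apply: contra xy => /eqP; rewrite sqnormE => /psumr_eq0P w0.
  apply/eqP/matrixP => i j; rewrite ord1; apply/eqP; rewrite -subr_eq0.
  have := w0 (fun i _ => sqr_ge0 _) i isT.
  by rewrite !mxE => /eqP; rewrite sqrf_eq0.
have wT : w^T = x^T - y^T by exact: linearB.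
have wwE : w^T *m w = (sqnorm w)%:M by rewrite [LHS]mx11.
have wx : w^T *m x = (sqnorm w / 2)%:M.
  rewrite [LHS]mx11; congr (_%:M).
  have xyE : (x^T *m y) 0 0 = (y^T *m x) 0 0.
    by rewrite -[x^T *m y]trmxK trmx_mul trmxK [LHS]mxE.
  have e1 : (w^T *m x) 0 0 = 1 - (y^T *m x) 0 0.
    by rewrite wT mulmxBl [LHS]mxE -[(x^T *m x) 0 0]/(sqnorm x) x1 mxE.
  have e2 : sqnorm w = 2 * (1 - (y^T *m x) 0 0).
    rewrite /sqnorm wT {1}/w mulmxBl mulmxBr mulmxBr.
    have mxB (a b : 'M[R]_1) : (a - b) 0 0 = a 0 0 - b 0 0 by rewrite !mxE.
    rewrite !mxB -[(x^T *m x) 0 0]/(sqnorm x) -[(y^T *m y) 0 0]/(sqnorm y).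
    by rewrite x1 y1 xyE; ring.
  by rewrite e1 e2 mulrC mulKf.
exists (1%:M - (2 / sqnorm w) *: (w *m w^T)).
  rewrite /orthogonal_group/= [(_ - _)^T]linearB/= trmx1.
  rewrite [(_ *: _)^T]linearZ/= trmx_mul trmxK.
  have WW : w *m w^T *m (w *m w^T) = sqnorm w *: (w *m w^T).
    by rewrite mulmxA -(mulmxA w) wwE mul_mx_scalar -scalemxAl.
  set k := 2 / sqnorm w.
  have kk : k * (k * sqnorm w) = k + k.
    by rewrite /k divfK// mulr_natr mulr2n.
  rewrite mulmxBl mul1mx mulmxBr mulmx1 -scalemxAl -scalemxAr WW !scalerA.
  by rewrite -mulrA kk scalerDl opprB addrK subrK.
rewrite mulmxBl mul1mx -scalemxAl -mulmxA wx mul_mx_scalar scalerA.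
by rewrite mulrA divfK// divff// scale1r /w opprB addrC subrK.
Qed.

End sqnorm.

(** * Uniqueness of rotation invariant measures on the sphere *)

Section invariant_measures.
Local Open Scope ereal_scope.
Variables (R : realType) (n : nat).
Local Notation V := 'cV[R]_n.
Local Notation S := (@unit_sphere R n).
Implicit Types (x y : V) (r : R).

Definition rotation_invariant (mu : set V -> \bar R) :=
  forall g, @orthogonal_group R n g -> forall A, measurable A ->
    mu ((fun x => g *m x)%R @^-1` A) = mu A.

(** The radius [r] bounds the squared distance, which avoids square roots.
    Euclidean balls, unlike those of the sup norm, are preserved by rotations. *)
Definition eball x r : set V := [set y | (sqnorm (y - x) < r)%R].

Definition near_pairs r : set (V * V) := [set z | (sqnorm (z.2 - z.1) < r)%R].

Lemma open_eball x r : open (eball x r).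
Proof.
have /continuousP := @continuous_sqnormB R n x.
by move=> /(_ [set t | (t < r)%R]); apply; exact: open_lt.
Qed.

Lemma measurable_eball x r : measurable (eball x r).
Proof. by apply: sub_sigma_algebra; exact: open_eball. Qed.

Lemma eball_sym x y r : eball x r y = eball y r x.
Proof. by rewrite /eball/= -sqnormN opprB. Qed.

Lemma measurable_near_pairs r : measurable (near_pairs r).
Proof.
have -> : near_pairs r =
    (fun z : V * V => sqnorm (z.2 - z.1)%R) @^-1` `]-oo, r[%classic.
  by apply/seteqP; split => z /=; rewrite in_itv.
rewrite -[X in measurable X]setTI.
apply: measurable_sqnorm => //.
by apply: measurable_funBmx; [exact: measurable_snd|exact: measurable_fst].
Qed.

Lemma eball_subset_open (G : set V) x : open G -> G x ->
  exists k, eball x (k.+1%:R^-1) `<=` G.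
Proof.
move=> oG Gx.
have /nbhs_ballP[e /= e0 xeG] : nbhs x G by exact: open_nbhs_nbhs.
have [k] : exists k, (0 + k.+1%:R^-1 < e ^+ 2)%R.
  by apply: ltr_add_invr; exact: exprn_gt0.
rewrite add0r => ke; exists k => y; rewrite /eball/= => xy.
apply: xeG; split => // i j; rewrite ord1 /ball/= distrC.
rewrite -(@ltr_pXn2r _ 2)// ?nnegrE ?(ltW e0)//.
apply: le_lt_trans ke; apply: le_trans (ltW xy).
rewrite sqnormE (bigD1 i)//= !mxE real_normK ?num_real// lerDl.
by apply: sumr_ge0 => ? _; exact: sqr_ge0.
Qed.

Lemma measure_setI_sphere (mu : {measure set V -> \bar R}) A :
  mu (~` S) = 0 -> measurable A -> mu (A `&` S) = mu A.
Proof.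
move=> muS mA; have mS := @measurable_sphere R n.
rewrite [in RHS](measureDI mu mA mS).
rewrite [X in _ = X + _](_ : _ = 0) ?add0e//.
apply: subset_measure0 muS; first exact: measurableD.
  exact: measurableC.
by move=> x [].
Qed.

Lemma eball_const (mu : {measure set V -> \bar R}) x y r :
  rotation_invariant mu -> S x -> S y -> mu (eball x r) = mu (eball y r).
Proof.
move=> muI Sx Sy; have [g og gx] := sphere_transitive Sx Sy.
rewrite -(muI g og _ (measurable_eball y r)); congr (mu _).
apply/seteqP; split => z; rewrite /eball/= -gx -mulmxBr sqnorm_orthogonal//.
Qed.

Section packing.
Variables mu nu : {finite_measure set V -> \bar R}.
Hypotheses (muI : rotation_invariant mu) (nuI : rotation_invariant nu).
Hypotheses (muS : mu (~` S) = 0) (nuS : nu (~` S) = 0).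

(** Both sides are masses of sets of pairs of close points [(x, y)]: on the left
    those with [x] in [H] for [mu], on the right those with [y] in [G] for [nu].
    Integrating first over the free point gives the mass of a ball, which does
    not depend on its centre, and the first set is contained in the second. *)
Lemma packing s r (H G : set V) : S s -> measurable H -> measurable G ->
  (forall x, H x -> eball x r `<=` G) ->
  nu (eball s r) * mu H <= mu (eball s r) * nu G.
Proof.
move=> Ss mH mG HG; have mS := @measurable_sphere R n.
have mHS : measurable (H `&` S) by exact: measurableI.
have mGS : measurable (G `&` S) by exact: measurableI.
pose E1 := near_pairs r `&` ((H `&` S) `*` S).
pose E2 := near_pairs r `&` (S `*` (G `&` S)).
have mE1 : measurable E1.
  apply: measurableI; first exact: measurable_near_pairs.
  exact: measurableX.
have mE2 : measurable E2.
  apply: measurableI; first exact: measurable_near_pairs.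
  exact: measurableX.
(* Each section is the trace on the sphere of a ball centred on the sphere,
   or is empty. *)
have -> : nu (eball s r) * mu H = (mu \x nu) E1.
  rewrite /product_measure1.
  rewrite (eq_integral (fun x => nu (eball s r) * (\1_(H `&` S) x)%:E)).
    rewrite ge0_integralZl//; first last.
    - by apply/measurable_EFinP; exact: measurable_indic.
    by rewrite integral_indic// setIT measure_setI_sphere.
  move=> x _; rewrite indicE /=.
  have -> : xsection E1 x = if x \in H `&` S then eball x r `&` S else set0.
    apply/seteqP; split => y; rewrite /xsection/= inE /E1/= /near_pairs/=.
      by case=> xy [HSx Sy]; rewrite mem_set.
    by case: ifPn => // /set_mem HSx [].
  case: ifPn => [/set_mem[Hx Sx]|_]; last by rewrite measure0 mule0.
  rewrite mule1 measure_setI_sphere//; last exact: measurable_eball.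
  exact: eball_const.
have -> : mu (eball s r) * nu G = (mu \x^ nu) E2.
  rewrite /product_measure2.
  rewrite (eq_integral (fun x => mu (eball s r) * (\1_(G `&` S) x)%:E)).
    rewrite ge0_integralZl//; first last.
    - by apply/measurable_EFinP; exact: measurable_indic.
    by rewrite integral_indic// setIT measure_setI_sphere.
  move=> y _; rewrite indicE /=.
  have -> : ysection E2 y = if y \in G `&` S then eball y r `&` S else set0.
    apply/seteqP; split => x; rewrite /ysection/= inE /E2/= /near_pairs/=.
      by case=> xy [Sx GSy]; rewrite mem_set//; split => //; rewrite eball_sym.
    by case: ifPn => // /set_mem GSy []; rewrite eball_sym.
  case: ifPn => [/set_mem[Gy Sy]|_]; last by rewrite measure0 mule0.
  rewrite mule1 measure_setI_sphere//; last exact: measurable_eball.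
  exact: eball_const.
have <- : (mu \x nu) E2 = (mu \x^ nu) E2.
  by apply: product_measure_unique => // A B mA mB; exact: product_measure2E.
apply: le_measure; rewrite ?inE//.
move=> [x y] [xy [[Hx Sx] Sy]]; split => //; split => //; split => //.
exact: HG Hx _ xy.
Qed.

End packing.

(** If one ball centred on the sphere were null, all of them would be; countably
    many rational boxes contained in such balls cover the sphere, which would be
    null too. *)
Lemma eball_gt0 (nu : {finite_measure set V -> \bar R}) s r : (0 < r)%R ->
  rotation_invariant nu -> S s -> nu S != 0 -> 0 < nu (eball s r).
Proof.
move=> r0 nuI Ss; rewrite lt0e measure_ge0 andbT; apply: contra => /eqP b0.
pose U (b : 'M[rat]_(n, 1) * nat) : set V :=
  if `[< exists2 x, S x & ratbox b `<=` eball x r >] then ratbox b else set0.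
pose F k := if unpickle k is Some b then U b else set0.
have SF : S `<=` \bigcup_k F k.
  move=> x Sx; have xx : eball x r x.
    by rewrite /eball/= subrr sqnormE big1// => i _; rewrite mxE expr0n.
  have [b [bx bE]] := open_ratbox (@open_eball x r) xx.
  exists (pickle b) => //; rewrite /F pickleK /U.
  by case: asboolP => // -[]; exists x.
have F0 k : nu.-negligible (F k).
  rewrite /F; case: unpickle => [b|]; last exact: negligible_set0.
  rewrite /U; case: asboolP => [[x Sx bE]|_]; last exact: negligible_set0.
  apply: negligibleS bE _; apply/negligibleP; first exact: measurable_eball.
  exact: etrans (eball_const r nuI Sx Ss) b0.
apply/eqP; apply/negligibleP; first exact: measurable_sphere.
exact: negligibleS SF (negligible_bigcup F0).
Qed.

(** The total mass as a nonnegative real number, for use as a scaling factor in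
    [mscale], so that cross-multiplied masses are themselves measures. *)
Definition total_mass (mu : {finite_measure set V -> \bar R}) : {nonneg R} :=
  NngNum (fine_ge0 (measure_ge0 mu setT)).

Lemma total_massE mu : (total_mass mu)%:num%:E = mu setT.
Proof. by rewrite /= fineK// fin_num_measure. Qed.

(** The sets [H k] of points whose ball of radius [1 / (k + 1)] lies in [G]
    increase to [G]; for each of them [packing] applies, and the common factor,
    the mass of a ball, is positive. *)
Lemma invariant_open_le (mu nu : {finite_measure set V -> \bar R}) (G : set V) :
  rotation_invariant mu -> rotation_invariant nu ->
  mu (~` S) = 0 -> nu (~` S) = 0 -> open G ->
  mscale (total_mass nu) mu G <= mscale (total_mass mu) nu G.
Proof.
move=> muI nuI muS nuS oG.
have mG : measurable G by exact: sub_sigma_algebra.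
have mS := @measurable_sphere R n.
have [nuS0|nuS0] := eqVneq (nu S) 0.
  have nuT : nu setT = 0.
    rewrite -nuS0; have := measure_setI_sphere nuS measurableT.
    by rewrite setTI => /esym.
  by rewrite {1}/mscale total_massE nuT mul0e.
have [s Ss] : S !=set0.
  by apply/set0P; apply: contra nuS0 => /eqP ->; rewrite measure0.
pose H k := [set x | eball x (k.+1%:R^-1) `<=` G].
have mH k : measurable (H k).
  rewrite -[H k]setCK; apply: measurableC; apply: sub_sigma_algebra.
  have -> : ~` H k = \bigcup_(y in ~` G) eball y (k.+1%:R^-1).
    apply/seteqP; split => [x /existsNP[y /not_implyP[xy Gy]]|x [y Gy xy] Hx].
      by exists y => //; rewrite eball_sym.
    by apply: Gy; apply: Hx; rewrite eball_sym.
  by apply: bigcup_open => y _; exact: open_eball.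
have GH : G = \bigcup_k H k.
  apply/seteqP; split => x.
    by move=> Gx; have [k kG] := eball_subset_open oG Gx; exists k.
  move=> [k _]; apply; rewrite /eball/= subrr sqnormE big1 ?invr_gt0// => i _.
  by rewrite mxE expr0n.
have ndH : nondecreasing_seq H.
  apply/nondecreasing_seqP => k; apply/subsetPset => x; apply: subset_trans => y.
  rewrite /eball/= => /lt_le_trans; apply.
  by rewrite lef_pV2 ?posrE// ler_nat.
have HG k : mscale (total_mass nu) mu (H k) <= mscale (total_mass mu) nu G.
  have r0 : (0 < k.+1%:R^-1 :> R)%R by rewrite invr_gt0.
  have b0 := eball_gt0 r0 nuI Ss nuS0.
  rewrite -(@lee_pmul2l _ (nu (eball s k.+1%:R^-1)))//; last first.
    by rewrite fin_num_measure//; exact: measurable_eball.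
  rewrite /mscale !total_massE.
  (* h1 compares H k with G; h2 compares the two ball masses *)
  have h1 := packing muI nuI muS nuS Ss (mH k) mG (fun x Hx => Hx).
  have h2 := packing nuI muI nuS muS Ss measurableT measurableT
    (fun x _ => @subsetT _ (eball x k.+1%:R^-1)).
  rewrite muleCA [leRHS]muleA.
  apply: (@le_trans _ _ (nu setT * (mu (eball s k.+1%:R^-1) * nu G))).
    by apply: lee_wpmul2l.
  rewrite muleA [nu setT * _]muleC.
  by apply: lee_wpmul2r.
rewrite [in leLHS]GH.
have cvgH : mscale (total_mass nu) mu \o H @ \oo -->
    mscale (total_mass nu) mu (\bigcup_k H k).
  by apply: nondecreasing_cvg_mu => //; rewrite -GH.
by apply: cvge_le cvgH; apply: nearW => k; exact: HG.
Qed.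

(** Cross-multiplying by the total masses, instead of normalizing, keeps the zero
    measure, which occurs as a law restricted to a null event. *)
Lemma invariant_measure_unique (mu nu : {finite_measure set V -> \bar R}) :
  rotation_invariant mu -> rotation_invariant nu ->
  mu (~` S) = 0 -> nu (~` S) = 0 ->
  forall A, measurable A -> nu setT * mu A = mu setT * nu A.
Proof.
move=> muI nuI muS nuS A mA; rewrite -!total_massE.
apply: (@measure_unique _ _ _ (@open V) (fun=> setT) _ _ _ _
  (mscale (total_mass nu) mu) (mscale (total_mass mu) nu)) => //.
- by move=> B C; exact: openI.
- by move=> _; exact: openT.
- by apply/seteqP; split => // x _; exists 0%N.
- by move=> G oG; apply/eqP; rewrite eq_le !invariant_open_le.
- by move=> _; rewrite -ge0_fin_numE ?measure_ge0// fin_num_measure.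
Qed.

End invariant_measures.

(** * Directions that are uniform on an event *)

Section law_on.
Local Open Scope ereal_scope.
Context d d' (T : measurableType d) (T' : measurableType d') (R : realType).
Variables (mu : {finite_measure set T -> \bar R}) (E : set T).
Variables (mE : measurable E) (f : {mfun T >-> T'}).

Definition law_on := pushforward (mrestr mu mE) f.

Let law_on0 : law_on set0 = 0. Proof. exact: measure0. Qed.

Let law_on_ge0 B : 0 <= law_on B. Proof. exact: measure_ge0. Qed.

Let law_on_sigma_additive : semi_sigma_additive law_on.
Proof. exact: measure_semi_sigma_additive. Qed.

HB.instance Definition _ := isMeasure.Build _ _ _ law_on
  law_on0 law_on_ge0 law_on_sigma_additive.

Let law_on_fin : fin_num_fun law_on.
Proof.
move=> B mB; apply: (fin_num_measure (mrestr mu mE)).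
exact: measurable_funPTI.
Qed.

HB.instance Definition _ := @Measure_isFinite.Build _ _ _ law_on law_on_fin.

End law_on.

Section uniform_on_event.
Local Open Scope ereal_scope.
Context d (T : measurableType d) (R : realType) (n : nat).
Variables (mu : probability T R) (V : {mfun T >-> 'cV[R]_n}) (E : set T).
Hypothesis mE : measurable E.
Hypothesis VS : mu (V @^-1` (~` @unit_sphere R n)) = 0.
Hypothesis VI : forall g, @orthogonal_group R n g -> forall B, measurable B ->
  mu ((fun w => g *m V w)%R @^-1` B `&` E) = mu (V @^-1` B `&` E).

(** The law of [V] restricted to [E] is a rotation invariant finite measure on the
    sphere, of total mass [mu E]. *)
Lemma uniform_on_event (nu : probability 'cV[R]_n R) :
  is_uniform_sphere nu -> forall B, measurable B ->
  mu (V @^-1` B `&` E) = mu E * nu B.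
Proof.
move=> [nuS nuI] B mB; have mS := @measurable_sphere R n.
have nuS0 : nu (~` @unit_sphere R n) = 0.
  by rewrite probability_setC// nuS subee.
have lawS : law_on mu mE V (~` @unit_sphere R n) = 0.
  apply: subset_measure0 VS.
  - by apply: measurableI => //; apply: measurable_funPTI; exact: measurableC.
  - by apply: measurable_funPTI; exact: measurableC.
  - by move=> w [].
have := @invariant_measure_unique _ _ (law_on mu mE V) nu VI nuI lawS nuS0 B mB.
rewrite [X in X * _ = _](_ : _ = 1) ?mul1e; last exact: probability_setT.
move=> lawB; apply: etrans lawB _; congr (_ * _).
by rewrite /law_on /pushforward/= /mrestr preimage_setT setTI.
Qed.

End uniform_on_event.

(** * Corner and directions of an orthogonal matrix *)

Section haar_blocks.
Variables (R : realType) (n : nat).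
Local Notation M := 'M[R]_(1 + n).
Implicit Types (G : M) (x : R) (g : 'M[R]_n).

Definition radius x : R := Num.sqrt (1 - x ^+ 2).

Definition corner G : R := ulsubmx G 0 0.

(** A unit vector when [G] is orthogonal and its corner lies in ]-1, 1[. When the
    radius is 0, its inverse is 0 and the direction is the zero vector. *)
Definition col_direction G : 'cV[R]_n := (radius (corner G))^-1 *: dlsubmx G.

Definition row_direction G : 'cV[R]_n :=
  (radius (corner G))^-1 *: (ursubmx G)^T.

Lemma measurable_radius : measurable_fun setT radius.
Proof.
apply: (measurableT_comp (continuous_measurable_fun (@sqrt_continuous R))).
by apply: measurable_funB => //; apply: measurable_funX.
Qed.

Lemma measurable_corner : measurable_fun setT corner.
Proof.
rewrite /corner; under eq_fun do rewrite !mxE; exact: measurable_entry.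
Qed.

Let measurable_inv_radius_corner :
  measurable_fun setT (fun G => (radius (corner G))^-1).
Proof.
(* Real powers are measurable, and the inverse of a nonnegative number is one *)
under eq_fun do rewrite -powR_inv1 ?sqrtr_ge0//.
apply: (measurableT_comp (@measurable_powR R (-1))).
exact: measurableT_comp measurable_radius measurable_corner.
Qed.

Lemma measurable_col_direction : measurable_fun setT col_direction.
Proof. apply: measurable_funZmx => //; exact: measurable_dlsubmx. Qed.

Lemma measurable_row_direction : measurable_fun setT row_direction.
Proof.
apply: measurable_funZmx => //.
apply: measurableT_comp (@measurable_ursubmx _ _ _ _ _).
exact: measurable_trmx.
Qed.

HB.instance Definition _ :=
  isMeasurableFun.Build _ _ _ _ corner measurable_corner.
HB.instance Definition _ :=
  isMeasurableFun.Build _ _ _ _ col_direction measurable_col_direction.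
HB.instance Definition _ :=
  isMeasurableFun.Build _ _ _ _ row_direction measurable_row_direction.

Lemma radius_gt0 x : `|x| < 1 -> 0 < radius x.
Proof.
by move=> x1; rewrite sqrtr_gt0 subr_gt0 -real_normK ?num_real// expr_lt1.
Qed.

Definition rotation_mx g : M := block_mx 1%:M 0 0 g.

Lemma orthogonal_rotation_mx g : orthogonal_group g ->
  orthogonal_group (rotation_mx g).
Proof.
rewrite /orthogonal_group/= => og; rewrite /rotation_mx tr_block_mx.
rewrite mulmx_block !trmx0 !mulmx0 !mul0mx trmx1 mulmx1 og !addr0 add0r.
by rewrite -scalar_mx_block.
Qed.

Lemma mul_rotation_mx g G : rotation_mx g *m G =
  block_mx (ulsubmx G) (ursubmx G) (g *m dlsubmx G) (g *m drsubmx G).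
Proof.
rewrite -{1}[G]submxK /rotation_mx mulmx_block.
by rewrite !mul1mx !mul0mx !addr0 !add0r.
Qed.

Lemma mul_mx_rotation g G : G *m rotation_mx g =
  block_mx (ulsubmx G) (ursubmx G *m g) (dlsubmx G) (drsubmx G *m g).
Proof.
rewrite -{1}[G]submxK /rotation_mx mulmx_block.
by rewrite !mulmx1 !mulmx0 !addr0 !add0r.
Qed.

Lemma corner_rotl g G : corner (rotation_mx g *m G) = corner G.
Proof. by rewrite /corner mul_rotation_mx block_mxKul. Qed.

Lemma corner_rotr g G : corner (G *m rotation_mx g) = corner G.
Proof. by rewrite /corner mul_mx_rotation block_mxKul. Qed.

Lemma col_direction_rotl g G :
  col_direction (rotation_mx g *m G) = g *m col_direction G.
Proof.
by rewrite /col_direction corner_rotl mul_rotation_mx block_mxKdl -scalemxAr.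
Qed.

Lemma row_direction_rotl g G :
  row_direction (rotation_mx g *m G) = row_direction G.
Proof. by rewrite /row_direction corner_rotl mul_rotation_mx block_mxKur. Qed.

Lemma row_direction_rotr g G :
  row_direction (G *m rotation_mx g^T) = g *m row_direction G.
Proof.
rewrite /row_direction corner_rotr mul_mx_rotation block_mxKur.
by rewrite trmx_mul trmxK -scalemxAr.
Qed.

Lemma orthogonal_group_tr m (h : 'M[R]_m) :
  orthogonal_group h -> orthogonal_group h^T.
Proof. by rewrite /orthogonal_group/= trmxK => /mulmx1C. Qed.

Lemma sqnorm_dlsubmx G : orthogonal_group G ->
  sqnorm (dlsubmx G) = 1 - corner G ^+ 2.
Proof.
rewrite /orthogonal_group/= -{1 2}[G]submxK tr_block_mx mulmx_block.
rewrite [1%:M]scalar_mx_block => /eq_block_mx[ul _ _ _].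
have /matrixP/(_ 0 0) := ul.
rewrite mxE [in RHS]mxE eqxx mulr1n -[((dlsubmx G)^T *m _) 0 0]/(sqnorm _).
rewrite mxE big_ord1 mxE -expr2 -/(corner G) => <-.
by rewrite addrAC subrr add0r.
Qed.

Lemma sqnorm_ursubmx G : orthogonal_group G ->
  sqnorm (ursubmx G)^T = 1 - corner G ^+ 2.
Proof.
move=> /orthogonal_group_tr /sqnorm_dlsubmx.
by rewrite -trmx_ursub /corner -trmx_ulsub [_^T 0 0]mxE.
Qed.

Lemma corner_bound G : orthogonal_group G -> corner G ^+ 2 <= 1.
Proof.
move=> /sqnorm_dlsubmx; rewrite sqnormE => e; rewrite -subr_ge0 -e.
by apply: sumr_ge0 => i _; exact: sqr_ge0.
Qed.

Lemma corner_lt1 G : orthogonal_group G -> corner G <> 1 -> corner G <> -1 ->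
  `|corner G| < 1.
Proof.
move=> /corner_bound + /eqP c1 /eqP cN1.
rewrite -real_normK ?num_real// expr_le1// le_eqVlt => /orP[|//].
by rewrite eqr_norml (negPf c1) (negPf cN1).
Qed.

Let scaled_on_sphere x (v : 'cV[R]_n) :
  `|x| < 1 -> sqnorm v = 1 - x ^+ 2 -> unit_sphere ((radius x)^-1 *: v).
Proof.
move=> x1 vx; have r0 := radius_gt0 x1.
rewrite unit_sphereE/= sqnormZ vx exprVn /radius sqr_sqrtr ?mulVf//.
  by move: r0; rewrite sqrtr_gt0 => /gt_eqF ->.
by move: r0; rewrite sqrtr_gt0 => /ltW.
Qed.

Lemma col_direction_sphere G : orthogonal_group G -> `|corner G| < 1 ->
  unit_sphere (col_direction G).
Proof. by move=> oG c1; apply: scaled_on_sphere; rewrite ?sqnorm_dlsubmx. Qed.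

Lemma row_direction_sphere G : orthogonal_group G -> `|corner G| < 1 ->
  unit_sphere (row_direction G).
Proof. by move=> oG c1; apply: scaled_on_sphere; rewrite ?sqnorm_ursubmx. Qed.

Lemma measurable_orthogonal_group : measurable (@orthogonal_group R (1 + n)).
Proof.
have -> : @orthogonal_group R (1 + n) =
  \bigcap_(ij in [set: 'I_(1 + n) * 'I_(1 + n)])
    ((fun G => (G^T *m G) ij.1 ij.2) @^-1` [set (1%:M : M) ij.1 ij.2]).
  apply/seteqP; split => G; first by move=> oG [i j] _ /=; rewrite oG.
  by move=> GE; apply/matrixP => i j; exact: (GE (i, j) I).
apply: fin_bigcap_measurable => // -[i j] _.
rewrite -[X in measurable X]setTI.
have mf : measurable_fun setT (fun G : M => (G^T *m G) i j).
  apply: (measurableT_comp (measurable_entry i j)).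
  by apply: measurable_mulmx => //; exact: measurable_trmx.
exact: mf.
Qed.

(** * Independence of corner and directions under the Haar law *)

Section haar.
Local Open Scope ereal_scope.
Variable mu : probability M R.
Hypothesis mu_haar : is_haar mu.
Hypothesis mu_corner : mu (corner @^-1` [set 1%R; (-1)%R]) = 0.

Let exceptional : set M :=
  ~` @orthogonal_group R (1 + n) `|` corner @^-1` [set 1%R; (-1)%R].

Let measurable_nonorthogonal : measurable (~` @orthogonal_group R (1 + n)).
Proof. by apply: measurableC; exact: measurable_orthogonal_group. Qed.

Let measurable_polar : measurable (corner @^-1` [set 1%R; (-1)%R]).
Proof. by apply: measurable_funPTI; exact: measurableU. Qed.

Let mu_exceptional : mu exceptional = 0.
Proof.
apply/negligibleP; first exact: measurableU.
apply: negligibleU; last exact/negligibleP.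
apply/negligibleP => //.
apply: etrans (probability_setC mu measurable_orthogonal_group) _.
by rewrite mu_haar.1 subee.
Qed.

Let regular G : ~ exceptional G -> orthogonal_group G /\ (`|corner G| < 1)%R.
Proof.
move=> /not_orP[/contrapT oG /not_orP[c1 c2]]; split => //.
exact: corner_lt1.
Qed.

Lemma haar_corner : mu (corner @^-1` `](-1)%R, 1%R[%classic) = 1.
Proof.
have mI : measurable (corner @^-1` `](-1)%R, 1%R[%classic).
  by apply: measurable_funPTI; exact: measurable_itv.
rewrite -[X in mu X]setCK.
apply: etrans (probability_setC mu (measurableC mI)) _.
rewrite [X in 1 - X](_ : _ = 0) ?sube0//.
apply: subset_measure0 mu_exceptional; [exact: measurableC|exact: measurableU|].
move=> G /= cG; apply: contrapT => /regular[_ c1]; apply: cG.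
by rewrite in_itv/= -ltr_norml.
Qed.

Let direction_sphere (V : {mfun M >-> 'cV[R]_n}) :
  (forall G, orthogonal_group G -> (`|corner G| < 1)%R -> unit_sphere (V G)) ->
  mu (V @^-1` (~` @unit_sphere R n)) = 0.
Proof.
move=> VS; apply: subset_measure0 mu_exceptional.
- by apply: measurable_funPTI; apply: measurableC; exact: measurable_sphere.
- exact: measurableU.
- by move=> G /= SG; apply: contrapT => /regular[oG c1]; apply: SG; exact: VS.
Qed.

(** Multiplication by diag(1, g) on the left moves only the column direction, so
    the column direction is uniform on every event about the row direction and
    the corner; what remains is handled by multiplication on the right by
    diag(1, g^T), which rotates the row direction by [g]. *)
Lemma haar_directions (nu1 nu2 : probability 'cV[R]_n R) A B1 B2 :
  is_uniform_sphere nu1 -> is_uniform_sphere nu2 ->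
  measurable A -> measurable B1 -> measurable B2 ->
  mu (col_direction @^-1` B1 `&` (row_direction @^-1` B2 `&` corner @^-1` A)) =
  mu (corner @^-1` A) * (nu1 B1 * nu2 B2).
Proof.
move=> nu1U nu2U mA mB1 mB2.
have mcA : measurable (corner @^-1` A) by exact: measurable_funPTI.
have mrB : measurable (row_direction @^-1` B2) by exact: measurable_funPTI.
have mcB : measurable (col_direction @^-1` B1) by exact: measurable_funPTI.
rewrite (@uniform_on_event _ _ _ _ mu col_direction _ _ _ _ nu1)//.
- rewrite (@uniform_on_event _ _ _ _ mu row_direction _ _ _ _ nu2)//.
  + by rewrite -muleA [nu2 _ * _]muleC.
  + exact: direction_sphere row_direction_sphere.
  + move=> g og B mB.
    have mE : measurable (row_direction @^-1` B `&` corner @^-1` A).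
      by apply: measurableI => //; exact: measurable_funPTI.
    have og' := orthogonal_rotation_mx (orthogonal_group_tr og).
    have [_ <-] := mu_haar.2 _ og' _ mE.
    by congr (mu _); apply/seteqP; split => G;
      rewrite /= row_direction_rotr corner_rotr.
- exact: measurableI.
- exact: direction_sphere col_direction_sphere.
- move=> g og B mB; set E := _ `&` corner @^-1` A.
  have mE : measurable (col_direction @^-1` B `&` E).
    apply: measurableI; first exact: measurable_funPTI.
    exact: measurableI.
  have [<- _] := mu_haar.2 _ (orthogonal_rotation_mx og) _ mE.
  by congr (mu _); apply/seteqP; split => G;
    rewrite /E /= col_direction_rotl row_direction_rotl corner_rotl.
Qed.

End haar.
End haar_blocks.

(** * The conditional distribution *)

Section products.
Local Open Scope ereal_scope.

(** Restricting to an event [E] allows [mu1] or [mu2] to be a law scaled by the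
    probability of [E]. *)
Lemma product_law d d1 d2 (T : measurableType d) (T1 : measurableType d1)
    (T2 : measurableType d2) (R : realType)
    (P : probability T R) (X1 : {mfun T >-> T1}) (X2 : {mfun T >-> T2})
    (mu1 : {finite_measure set T1 -> \bar R})
    (mu2 : {finite_measure set T2 -> \bar R}) E (mE : measurable E) :
  (forall B1 B2, measurable B1 -> measurable B2 ->
    P (X1 @^-1` B1 `&` X2 @^-1` B2 `&` E) = mu1 B1 * mu2 B2) ->
  forall B, measurable B ->
    P ((fun w => (X1 w, X2 w)) @^-1` B `&` E) = (mu1 \x mu2) B.
Proof.
move=> PE B mB.
have mX : measurable_fun setT (fun w => (X1 w, X2 w)).
  by apply: measurable_fun_pair; exact: measurable_funPT.
pose X : {mfun T >-> (T1 * T2)%type} := mfun_Sub (mem_set mX).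
apply/esym; exact: (product_measure_unique (m' := law_on P mE X)).
Qed.

End products.

Section unscaling.
Variables (R : realType) (n : nat).
Local Notation M := 'M[R]_(1 + n).

(** The event that the scaled pair falls in [B], in terms of the corner and the
    two directions; its section at [x] is the set of pairs of directions which
    the radius of [x] scales into [B]. *)
Definition scaled_set (B : set ('cV[R]_n * 'rV[R]_n)) :
    set (R * ('cV[R]_n * 'cV[R]_n)) :=
  [set z | B (radius z.1 *: z.2.1, (radius z.1 *: z.2.2^T))].

Lemma measurable_scaled_set B : measurable B -> measurable (scaled_set B).
Proof.
move=> mB; rewrite -[X in measurable X]setTI.
have mr : measurable_fun setT (fun z : R * ('cV[R]_n * 'cV[R]_n) => radius z.1).
  exact: measurableT_comp (@measurable_radius R) measurable_fst.
have m1 : measurable_fun setT (fun z : R * ('cV[R]_n * 'cV[R]_n) => z.2.1).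
  exact: measurableT_comp measurable_fst measurable_snd.
have m2 : measurable_fun setT (fun z : R * ('cV[R]_n * 'cV[R]_n) => z.2.2^T).
  apply: (measurableT_comp (@measurable_trmx R n 1)).
  exact: measurableT_comp measurable_snd measurable_snd.
exact: (measurable_fun_pair (measurable_funZmx mr m1) (measurable_funZmx mr m2)).
Qed.

Lemma scaled_setE B (G : M) : `|corner G| < 1 ->
  scaled_set B (corner G, (col_direction G, row_direction G)) <->
  B (dlsubmx G, ursubmx G).
Proof.
move=> /radius_gt0/lt0r_neq0 r0.
rewrite /scaled_set/= /col_direction /row_direction.
by rewrite [(_ *: _)^T]linearZ/= trmxK !scalerA divff// !scale1r.
Qed.

End unscaling.

Theorem theorem1p1 (R : realType) (p : nat) (hp : (2 <= p)%N)
  (d : measure_display) (T : measurableType d) (P : probability T R)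
  (Gamma : {RV P >-> 'M[R]_(1 + p.-1)})
  (Gamma_haar : is_haar (distribution P Gamma))
  (Gamma11_removed : forall w : T,
     block11 Gamma w <> 1 /\ block11 Gamma w <> -1)
  (d' : measure_display) (T' : measurableType d') (Q : probability T' R)
  (U1 U2 : {RV Q >-> 'cV[R]_(p.-1)})
  (U_indep : independent_RV U1 U2)
  (U1_unif : is_uniform_sphere (distribution Q U1))
  (U2_unif : is_uniform_sphere (distribution Q U2)) :
  is_conditional_distribution (P := P) (block21_12 Gamma) (block11 Gamma)
    `]-1, 1[
    (fun gamma : R =>
       distribution Q (scaled_pair (Num.sqrt (1 - gamma ^+ 2)) U1 U2)).
Proof.
set n := p.-1 in Gamma Gamma_haar Gamma11_removed U1 U2 U_indep U1_unif
  U2_unif *.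
pose mu := distribution P Gamma.
have mu_corner : mu (@corner R n @^-1` [set 1; -1]) = 0%E.
  rewrite /mu /distribution /pushforward.
  rewrite (_ : _ @^-1` _ = set0) ?measure0//.
  apply/seteqP; split => w // cw; have [c1 c2] := Gamma11_removed w.
  by case: cw.
have mU : measurable_fun setT (fun w => (U1 w, U2 w)).
  by apply: measurable_fun_pair; exact: measurable_funPT.
pose U : {mfun T' >-> ('cV[R]_n * 'cV[R]_n)%type} := mfun_Sub (mem_set mU).
pose lawU : probability _ R := distribution Q U.
have KE gamma B : distribution Q (scaled_pair (radius gamma) U1 U2) B =
    lawU (xsection (scaled_set B) gamma).
  congr (Q _); apply/seteqP; split => w /=; by rewrite /xsection/= inE.
(* The pair of directions has law lawU and is independent of the corner: the
   product formula of haar_directions extends from rectangles to Borel sets. *)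
have directionsE A B : measurable A -> measurable B ->
    mu ((fun G => (col_direction G, row_direction G)) @^-1` B `&`
        @corner R n @^-1` A) = (mu (@corner R n @^-1` A) * lawU B)%E.
  move=> mA mB.
  have mcA : measurable (@corner R n @^-1` A) by exact: measurable_funPTI.
  pose muA : {nonneg R} :=
    NngNum (fine_ge0 (measure_ge0 mu (@corner R n @^-1` A))).
  have muAE : muA%:num%:E = mu (@corner R n @^-1` A).
    by rewrite /= fineK// fin_num_measure.
  transitivity ((mscale muA (distribution Q U1) \x distribution Q U2)%E B).
    apply: (@product_law _ _ _ _ _ _ _ mu (@col_direction R n)
      (@row_direction R n) (mscale muA (distribution Q U1)) (distribution Q U2)
      _ mcA) => //.
    move=> B1 B2 mB1 mB2; rewrite -setIA.
    apply: etrans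
      (haar_directions Gamma_haar mu_corner U1_unif U2_unif mA mB1 mB2) _.
    by rewrite /mscale muAE -muleA; congr (_ * _)%E.
  have mBx := measurable_fun_xsection (distribution Q U2) mB.
  apply: etrans
    (ge0_integral_mscale (distribution Q U1) measurableT muA mBx _) _ => //.
  rewrite muAE; congr (_ * _)%E; apply/esym.
  have := @product_law _ _ _ _ _ _ _ Q U1 U2 (distribution Q U1)
    (distribution Q U2) setT measurableT _ B mB.
  rewrite setIT; apply => B1 B2 mB1 mB2; rewrite setIT; exact: U_indep.
split.
- exact: measurable_itv.
- exact: haar_corner Gamma_haar mu_corner.
- move=> B mB; apply: measurable_funTS.
  rewrite (_ : (fun x => _) = lawU \o xsection (scaled_set B)); last first.
    by apply/funext => x; exact: KE.
  apply: measurable_fun_xsection; exact: measurable_scaled_set.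
- move=> A B mA AD mB.
  have A1 x : A x -> `|x| < 1.
    by move=> /AD; rewrite /= in_itv/= -ltr_norml.
  (* On A the radius is positive, so F is the event to be computed, expressed
     through the corner and the directions. *)
  pose F := scaled_set B `&` (A `*` setT).
  have mF : measurable F.
    by apply: measurableI; [exact: measurable_scaled_set|exact: measurableX].
  have mD : measurable_fun setT
      (fun G : 'M[R]_(1 + n) => (col_direction G, row_direction G)).
    by apply: measurable_fun_pair; exact: measurable_funPT.
  pose D : {mfun 'M[R]_(1 + n) >-> ('cV[R]_n * 'cV[R]_n)%type} :=
    mfun_Sub (mem_set mD).
  transitivity (mu ((fun w => (corner w, D w)) @^-1` F `&` setT)).
    congr (P _); apply/seteqP; split => w /=.
      case=> Aw Bw; split => //; split => //=.
      by apply/(@scaled_setE R n B (Gamma w)) => //; exact: A1 Aw.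
    case=> -[Bw [Aw _] _]; split => //.
    by apply/(@scaled_setE R n B (Gamma w)) => //; exact: A1 Aw.
  transitivity ((distribution P (block11 Gamma) \x lawU)%E F).
    apply: (@product_law _ _ _ _ _ _ _ mu (@corner R n) D
      (distribution P (block11 Gamma)) lawU setT measurableT) => //.
    move=> B1 B2 mB1 mB2; rewrite setIT setIC; exact: directionsE mB1 mB2.
  rewrite [RHS]integral_mkcond /product_measure1; apply: eq_integral => x _.
  rewrite patchE; case: ifPn => [/set_mem Ax|/negP Ax].
    apply: etrans (esym (KE x B)); congr (lawU _).
    by apply/seteqP; split => z; rewrite /xsection/= !inE => // -[].
  rewrite [RHS](_ : _ = lawU set0); last by rewrite measure0.
  congr (lawU _); apply/seteqP; split => z //.
  by rewrite /xsection/= inE => -[_ [Az _]]; apply: Ax; exact: mem_set.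
Qed.
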